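(* Let $\mathcal{H}$ be a complex Hilbert space, $l$ and $n$ positive integers, and $\Omega\subseteq\mathbb{C}$ a domain. Let $f$ and $\widetilde f$ be $n$-nondegenerate holomorphic maps from $\Omega$ to $Gr(l,\mathcal{H})$, with associated holomorphic Hermitian vector bundles $E$ and $\widetilde E$. Fix a point $z_0\in\Omega$. The following are equivalent: (i) $f$ and $\widetilde f$ have contact of order $n$ at $z_0$. (ii) There is a linear isometric map $\Phi$ from $E^n(z_0)$ to $\widetilde E^n(z_0)$ such that $\Phi P=\widetilde P\Phi$, where $P$ and $\widetilde P$ are the Pascal maps on $E^n$ and $\widetilde E^n$ (acting on the fibers at $z_0$).
   Context: $Gr(l,\mathcal{H})$ is the Grassmannian of $l$-dimensional subspaces of $\mathcal{H}$. A map $f:\Omega\to Gr(l,\mathcal{H})$ is holomorphic if for each $w\in\Omega$ there exist a neighborhood $\Delta$ of $w$ and holomorphic $\mathcal{H}$-valued functions $s_1,\dots,s_l$ on $\Delta$ such that $f(z)$ is the linear span of $s_1(z),\dots,s_l(z)$ for every $z\in\Delta$. Such $\mathbf{s}=\{s_1,\dots,s_l\}$ is called a holomorphic frame for $f$ around $w$; it is a local holomorphic frame of the associated holomorphic vector bundle $E=\{(h,z)\in\mathcal{H}\times\Omega: h\in f(z)\}$. The map $f$ is $n$-nondegenerate if for every $z\in\Omega$ the vectors $s_i^{(k)}(z)$, $1\le i\le l$, $0\le k\le n$, are linearly independent, where $\mathbf{s}$ is a holomorphic frame for $f$ around $z$ and $s_i^{(k)}$ is the $k$-th derivative of $s_i$;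 this does not depend on the choice of frame. The $n$-jet bundle $E^n$ of $E$ has fiber $E^n(z)=\mathrm{span}\{s_i^{(k)}(z):1\le i\le l,\ 0\le k\le n\}\subseteq\mathcal{H}$ at $z$, which is independent of the holomorphic frame $\mathbf{s}$ around $z$. The fibers of $E$ and $E^n$ carry the inner product inherited from $\mathcal{H}$. The Pascal map $P$ on $E^n$ is the bundle map acting on each fiber $E^n(z)$ as the linear map with $P s_i(z)=0$ and $P s_i^{(k)}(z)=k\,s_i^{(k-1)}(z)$ for $1\le i\le l$, $1\le k\le n$; it is independent of the choice of holomorphic frame $\mathbf{s}$. The objects $\widetilde E$, $\widetilde E^n$, $\widetilde P$ are defined likewise from $\widetilde f$. Two holomorphic maps $f$ and $\widetilde f$ from $\Omega$ to $Gr(l,\mathcal{H})$ have contact of order $n$ at $z_0$ if there exist holomorphic frames $\mathbf{s}=\{s_1,\dots,s_l\}$ for $f$ and $\widetilde{\mathbf{s}}=\{\widetilde s_1,\dots,\widetilde s_l\}$ for $\widetilde f$ around $z_0$ such that the linear map from $E^n(z_0)$ to $\widetilde E^n(z_0)$ defined by $s_i^{(k)}(z_0)\mapsto\widetilde s_i^{(k)}(z_0)$, $1\le i\le l$, $0\le k\le n$, is isometric. *)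

(* Defs.v *)
From HB Require Import structures.
From mathcomp Require Import all_boot all_order all_algebra.
From mathcomp Require Import sesquilinear.
From mathcomp Require Import all_classical all_reals all_analysis.
Import numFieldNormedType.Exports.
Import Order.TTheory GRing.Theory Num.Theory.

Set Implicit Arguments.
Unset Strict Implicit.
Unset Printing Implicit Defensive.

Local Open Scope ring_scope.
Local Open Scope classical_set_scope.

(* The field of complex numbers is [R[i]] for [R : realType]. The definitions  *)
(* only use its structure of numClosedFieldType [C], from which                *)
(* MathComp-Analysis derives the topology of the modulus.                      *)

(* [H] is a Hilbert space when it is complete and its norm comes from the      *)
(* inner product [dot] (conjugate-linear in the second argument).              *)
Definition norm_from_dot (C : numClosedFieldType) (H : normedModType C)
    (dot : {dot H for Num.conj}) : Prop :=
  forall x : H, `|x| ^+ 2 = dot x x.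

Definition domain (C : numClosedFieldType) (Omega : set C) : Prop :=
  [/\ open Omega, connected Omega & Omega !=set0].

Section LinearAlgebra.
Variables (C : numClosedFieldType) (H : normedModType C).

Definition lin_span (I : finType) (v : I -> H) : set H :=
  [set h | exists c : I -> C, h = \sum_i c i *: v i].

Definition lin_indep (I : finType) (v : I -> H) : Prop :=
  forall c : I -> C, \sum_i c i *: v i = 0 -> forall i, c i = 0.

Definition Gr (l : nat) : set (set H) :=
  [set V | exists2 v : 'I_l -> H, lin_indep v & V = lin_span v].

(* Maps between subspaces [A] and [B] of [H] are represented by total maps     *)
(* [H -> H], of which only the values on [A] matter.                           *)
Definition linear_on (A : set H) (T : H -> H) : Prop :=
  forall (a : C) (x y : H), A x -> A y -> T (a *: x + y) = a *: T x + T y.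

Definition linear_isometry_on (A B : set H) (T : H -> H) : Prop :=
  [/\ forall x, A x -> B (T x), linear_on A T &
      forall x, A x -> `|T x| = `|x|].

End LinearAlgebra.

(* ['d g z] is the complex-linear differential of [g] at [z], so [cderiv g z]  *)
(* is the complex derivative, equal to [g^`() z] where [g] is differentiable   *)
(* (derive1E'). Elsewhere ['d g z] is the null map, while the value of         *)
(* [g^`() z] would be the unspecified default point of [H].                    *)
Definition cderiv (C : numClosedFieldType) (H : normedModType C)
    (g : C -> H) (z : C) : H :=
  'd g z 1.

Definition cderivn (C : numClosedFieldType) (H : normedModType C)
    (k : nat) (g : C -> H) : C -> H :=
  iter k (@cderiv C H) g.

(* Maps from [Omega] to the Grassmannian are total maps [C -> set H], whose    *)
(* values outside of [Omega] are never used.                                   *)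
Section Bundle.
Variables (C : numClosedFieldType) (H : normedModType C).
Variables (Omega : set C) (l : nat).
Implicit Types (f : C -> set H) (s : 'I_l -> C -> H) (w z : C).

Definition holomorphic_on (Delta : set C) (g : C -> H) : Prop :=
  forall z, Delta z -> differentiable g z.

Definition holomorphic_frame f w s : Prop :=
  exists Delta : set C,
    [/\ open Delta, Delta w, Delta `<=` Omega,
        forall i, holomorphic_on Delta (s i) &
        forall z, Delta z -> f z = lin_span (fun i => s i z)].

Definition holomorphic_map f : Prop :=
  (forall z, Omega z -> Gr l (f z)) /\
  (forall w, Omega w -> exists s, holomorphic_frame f w s).

(* The family of the [s_i^(k)(z)], 1 <= i <= l, 0 <= k <= n.                   *)
Definition jet (n : nat) s z (ik : 'I_l * 'I_n.+1) : H :=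
  cderivn ik.2 (s ik.1) z.

Definition n_nondegenerate (n : nat) f : Prop :=
  forall z, Omega z ->
    forall s, holomorphic_frame f z s -> lin_indep (@jet n s z).

Definition jet_fiber (n : nat) f z : set H :=
  [set h | exists2 s, holomorphic_frame f z s & lin_span (@jet n s z) h].

(* [T] is, on the span of the jet of [s] at [z], the linear map with           *)
(* [s_i(z) |-> 0] and [s_i^(k)(z) |-> k s_i^(k-1)(z)].                         *)
Definition pascal_for (n : nat) s z (T : H -> H) : Prop :=
  [/\ linear_on (lin_span (@jet n s z)) T,
      forall i, T (s i z) = 0 &
      forall i (k : nat), (1 <= k <= n)%N ->
        T (cderivn k (s i) z) = k%:R *: cderivn k.-1 (s i) z].

(* The Pascal map on the fiber at [z], built from some holomorphic frame       *)
(* around [z]; as that choice is immaterial on [jet_fiber n f z], it is left   *)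
(* to [get]. The values outside of the fiber are arbitrary.                    *)
Definition pascal (n : nat) f z : H -> H :=
  get [set T | exists2 s, holomorphic_frame f z s & pascal_for n s z T].

Definition contact (n : nat) f ft z : Prop :=
  exists s st : 'I_l -> C -> H,
    [/\ holomorphic_frame f z s, holomorphic_frame ft z st &
        exists2 T : H -> H,
          forall i (k : nat), (k <= n)%N ->
            T (cderivn k (s i) z) = cderivn k (st i) z &
          linear_isometry_on (jet_fiber n f z) (jet_fiber n ft z) T].

End Bundle.

(* Main.v *)
(* The jets of a frame being linearly independent, the derivatives of a
   frame up to order n exist, and they transform under a change of frame by
   Leibniz' rule; the transition matrix is holomorphic because it is a quotient
   of Gram matrices against the fixed vectors s_j(z). Hence the jet fibre and
   the Pascal map can be computed in any frame, and an isometry matching two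
   jets intertwines the Pascal maps. Conversely, if Phi intertwines them, write
   Phi s_i^(k) = sum_(j,m) c_(i,k,j,m) t_j^(m) in a frame t of the second map.
   Intertwining forces c_(i,k,j,m) = binom(k,m) c_(i,k-m,j,0), which is
   Leibniz' rule at z_0 for the frame sum_j A_ij t_j, where A_ij is the
   polynomial sum_r c_(i,r,j,0) (z - z_0)^r / r!. *)

Require Import Defs.
From HB Require Import structures.
From mathcomp Require Import all_boot all_order all_algebra.
From mathcomp Require Import sesquilinear complex.
From mathcomp Require Import all_classical all_reals all_analysis ring.
Import numFieldNormedType.Exports.
Import Order.TTheory GRing.Theory Num.Theory.

Set Implicit Arguments.
Unset Strict Implicit.
Unset Printing Implicit Defensive.

Local Open Scope ring_scope.
Local Open Scope complex_scope.
Local Open Scope classical_set_scope.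

(** * The complex derivative: locality and the product rule *)

Section Derivative.
Variables (C : numClosedFieldType) (H : normedModType C).
Implicit Types (g : C -> H) (a : C -> C) (z : C).

Lemma is_derive_cderiv g z (d : H) :
  is_derive z 1 g d -> differentiable g z /\ cderiv g z = d.
Proof.
move=> [dg <-]; have dg' : differentiable g z by apply/derivable1_diffP.
by split=> //; rewrite deriveE.
Qed.

Lemma differentiable_is_derive g z :
  differentiable g z -> is_derive z 1 g (cderiv g z).
Proof. by move=> dg; split; [exact/derivable1_diffP | rewrite deriveE]. Qed.

(** ['d g z] is a choice with the null map as default, so a nonzero value shows that a genuine
    differential was chosen. *)
Lemma cderiv_neq0_differentiable g z : cderiv g z != 0 -> differentiable g z.
Proof.
rewrite /cderiv /diff; case: xgetP => /= [df ->|]; last by rewrite eqxx.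
by move=> dfP _; apply/diffP.
Qed.

(** Differentiability of either function passes to the other; if both fail it, both sides are the
    default 0. *)
Lemma near_eq_cderiv g h z : (\near z, g z = h z) -> cderiv g z = cderiv h z.
Proof.
move=> gh; have hg : \near z, h z = g z by near do apply/esym.
have [dg|ndg] := pselect (differentiable g z).
  by have [] := is_derive_cderiv
    (near_eq_is_derive gh (differentiable_is_derive dg)).
have [dh|ndh] := pselect (differentiable h z).
  by have [] := is_derive_cderiv
    (near_eq_is_derive hg (differentiable_is_derive dh)).
have cderiv0 (k : C -> H) : ~ differentiable k z -> cderiv k z = 0.
  by move=> nk; have [//|/cderiv_neq0_differentiable/nk] := eqVneq (cderiv k z) 0.
by rewrite !cderiv0.
Unshelve. all: by end_near. Qed.

(** Scaling is a continuous bilinear map on [C^o * H]; the product rule is the chain rule through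
    the pair [(a, g)]. *)
Lemma is_derive_scale a g z (da : C) (dg : H) :
  is_derive z 1 a da -> is_derive z 1 g dg ->
  is_derive z 1 (fun w => a w *: g w) (da *: g z + a z *: dg).
Proof.
move=> [/derivable1_diffP ha <-] [/derivable1_diffP hg <-].
have bil : bilinear_for
    (GRing.Scale.Law.clone _ _ *:%R _) (GRing.Scale.Law.clone _ _ *:%R _)
    (@GRing.scale C H : C^o -> H -> H).
  split=> [v|b] k x y /=; first by rewrite scalerDl scalerA.
  by rewrite scalerDr !scalerA mulrC.
pose M := bilinear_isBilinear.Build C C^o H H _ _ _ bil.
pose B : {bilinear C^o -> H -> H} := HB.pack (@GRing.scale C H : C^o -> H -> H) M.
have Bc : continuous (fun p : C^o * H => B p.1 p.2) by exact: scale_continuous.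
have Bd := differentiableP (differentiable_bilin (a z, g z) Bc).
have pd := is_diff_pair (differentiableP ha) (differentiableP hg).
have [d e] := is_diff_comp pd Bd.
split; first by apply/derivable1_diffP.
by rewrite deriveE// e (diff_bilin (a z, g z) Bc) /= !deriveE// addrC.
Qed.

End Derivative.

(** * Functions that are [n] times complex differentiable on an open set *)

(** The order is finite and counted explicitly, since the frames are only ever differentiated up to
    order [n]. At [n = 0] the condition is empty, which starts every induction below. *)
Definition cdiffn (C : numClosedFieldType) (H : normedModType C) (n : nat)
    (D : set C) (g : C -> H) : Prop :=
  forall k, (k < n)%N -> holomorphic_on D (cderivn k g).

Section Cdiffn.
Variables (C : numClosedFieldType) (D : set C).
Hypothesis D_open : open D.

Lemma cderivSn (H : normedModType C) k (g : C -> H) :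
  cderivn k.+1 g = cderivn k (cderiv g).
Proof. by rewrite /cderivn iterSr. Qed.

Lemma near_open (z : C) : D z -> \near z, D z.
Proof. by move=> Dz; apply: open_nbhs_nbhs. Qed.

Lemma eq_on_near (T : Type) (g h : C -> T) :
  {in D, g =1 h} -> forall z, D z -> \near z, g z = h z.
Proof.
by move=> gh z /near_open; apply: filterS => w Dw; exact/gh/mem_set.
Qed.

Lemma eq_on_cderiv (H : normedModType C) (g h : C -> H) :
  {in D, g =1 h} -> {in D, cderiv g =1 cderiv h}.
Proof.
by move=> gh z /set_mem Dz; apply: near_eq_cderiv; exact: eq_on_near.
Qed.

Lemma eq_on_cderivn (H : normedModType C) (g h : C -> H) k :
  {in D, g =1 h} -> {in D, cderivn k g =1 cderivn k h}.
Proof. by move=> gh; elim: k => //= k; exact: eq_on_cderiv. Qed.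

Lemma eq_on_holomorphic (H : normedModType C) (g h : C -> H) :
  {in D, g =1 h} -> holomorphic_on D g -> holomorphic_on D h.
Proof.
move=> gh hg z Dz.
by have [] := is_derive_cderiv (near_eq_is_derive (eq_on_near gh Dz)
  (differentiable_is_derive (hg z Dz))).
Qed.

Lemma eq_on_cdiffn (H : normedModType C) (g h : C -> H) n :
  {in D, g =1 h} -> cdiffn n D g -> cdiffn n D h.
Proof.
move=> gh hg k kn; apply: eq_on_holomorphic (hg k kn).
exact: eq_on_cderivn.
Qed.

Lemma cdiffnS (H : normedModType C) (g : C -> H) n :
  cdiffn n.+1 D g <-> holomorphic_on D g /\ cdiffn n D (cderiv g).
Proof.
split=> [gP|[g0 gP] [//|k]].
  by split=> [|k kn]; [exact: gP 0%N _ | rewrite -cderivSn; exact: gP].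
by rewrite ltnS cderivSn; exact: gP.
Qed.

Lemma cdiffn_le (H : normedModType C) (g : C -> H) m n :
  (m <= n)%N -> cdiffn n D g -> cdiffn m D g.
Proof. by move=> mn gP k km; apply: gP; exact: leq_trans mn. Qed.

(** The induction step of all the closure properties: it suffices to exhibit a formula for the
    derivative on [D] that has order [n]. *)
Lemma cdiffn_is_derive (H : normedModType C) (g dg : C -> H) n :
  (forall z, D z -> is_derive z 1 g (dg z)) -> cdiffn n D dg ->
  cdiffn n.+1 D g.
Proof.
move=> gd dgP; apply/cdiffnS; split=> [z /gd/is_derive_cderiv[]//|].
by apply: eq_on_cdiffn dgP => z /set_mem/gd/is_derive_cderiv[].
Qed.

Lemma cdiffn_derive (H : normedModType C) (g : C -> H) n :
  cdiffn n.+1 D g -> forall z, D z -> is_derive z 1 g (cderiv g z).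
Proof. by move=> /cdiffnS[gh _] z /gh; exact: differentiable_is_derive. Qed.

Lemma cdiffn_cst (H : normedModType C) (h : H) n : cdiffn n D (fun=> h).
Proof.
elim: n h => // n IHn h; exact: (@cdiffn_is_derive _ _ (fun=> 0)).
Qed.

Lemma cdiffnD (H : normedModType C) (g h : C -> H) n :
  cdiffn n D g -> cdiffn n D h -> cdiffn n D (fun z => g z + h z).
Proof.
elim: n g h => // n IHn g h gP hP.
apply: (@cdiffn_is_derive _ _ (fun z => cderiv g z + cderiv h z)).
  by move=> z Dz; apply: is_deriveD;
    [exact: cdiffn_derive gP _ Dz|exact: cdiffn_derive hP _ Dz].
by apply: IHn; [case/cdiffnS: gP|case/cdiffnS: hP].
Qed.

Lemma cdiffn_scale (H : normedModType C) (a : C -> C) (g : C -> H) n :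
  cdiffn n D a -> cdiffn n D g -> cdiffn n D (fun z => a z *: g z).
Proof.
elim: n a g => // n IHn a g aP gP.
apply: (@cdiffn_is_derive _ _ (fun z => cderiv a z *: g z + a z *: cderiv g z)).
  by move=> z Dz; apply: is_derive_scale;
    [exact: cdiffn_derive aP _ Dz|exact: cdiffn_derive gP _ Dz].
have [[_ a'P] [_ g'P]] := (proj1 (cdiffnS _ _) aP, proj1 (cdiffnS _ _) gP).
(* In each term the factor left underived has order [n.+1], one more than the induction hypothesis
   asks. *)
by apply: cdiffnD; apply: IHn => //; [exact: cdiffn_le gP|exact: cdiffn_le aP].
Qed.

Lemma cdiffn_sum (H : normedModType C) (I : Type) (r : seq I) (P : pred I)
    (F : I -> C -> H) n :
  (forall i, P i -> cdiffn n D (F i)) ->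
  cdiffn n D (fun z => \sum_(i <- r | P i) F i z).
Proof.
move=> FP; elim: r => [|i r IHr].
  apply: eq_on_cdiffn (@cdiffn_cst H 0 n) => z _.
  by rewrite big_nil.
case Pi: (P i); last by apply: eq_on_cdiffn IHr => z _; rewrite big_cons Pi.
apply: eq_on_cdiffn (cdiffnD (FP i Pi) IHr) => z _; by rewrite big_cons Pi.
Qed.

Lemma cdiffnM (a b : C -> C) n :
  cdiffn n D a -> cdiffn n D b -> cdiffn n D (fun z => a z * b z).
Proof. exact: cdiffn_scale. Qed.

Lemma cdiffn_prod (I : Type) (r : seq I) (P : pred I) (F : I -> C -> C) n :
  (forall i, P i -> cdiffn n D (F i)) ->
  cdiffn n D (fun z => \prod_(i <- r | P i) F i z).
Proof.
move=> FP; elim: r => [|i r IHr].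
  have c1 : cdiffn n D (fun=> 1 : C) by exact: cdiffn_cst.
  apply: eq_on_cdiffn c1 => z _.
  by rewrite big_nil.
case Pi: (P i); last by apply: eq_on_cdiffn IHr => z _; rewrite big_cons Pi.
apply: eq_on_cdiffn (cdiffnM (FP i Pi) IHr) => z _; by rewrite big_cons Pi.
Qed.

(** The derivative of the inverse is a product of the inverse itself, known to have order [n] by
    induction, and [cderiv a]. *)
Lemma cdiffnV (a : C -> C) n :
  (forall z, D z -> a z != 0) -> cdiffn n D a ->
  cdiffn n D (fun z => (a z)^-1).
Proof.
move=> a0; elim: n => // n IHn aP.
have aV := IHn (cdiffn_le (leqnSn n) aP).
apply: (@cdiffn_is_derive _ _
  (fun z => (- 1 * ((a z)^-1 * (a z)^-1)) *: cderiv a z)).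
  move=> z Dz; have [ad <-] := cdiffn_derive aP Dz.
  split; first exact: derivableV (a0 z Dz) ad.
  by rewrite deriveV ?a0// mulN1r -invfM.
apply: cdiffn_scale; last by case/cdiffnS: aP.
by apply: cdiffnM; [exact: cdiffn_cst | exact: cdiffnM].
Qed.

Lemma cdiffn_det n p (A : C -> 'M[C]_p) :
  (forall i j, cdiffn n D (fun z => A z i j)) -> cdiffn n D (fun z => \det (A z)).
Proof.
move=> AP; apply: cdiffn_sum => s _; apply: cdiffnM; first exact: cdiffn_cst.
by apply: cdiffn_prod => i _.
Qed.

(** Cramer's rule: each entry of the inverse is a cofactor over the determinant, both polynomial in
    the entries of [A]. *)
Lemma cdiffn_invmx n p (A : C -> 'M[C]_p) :
  (forall z, D z -> A z \in unitmx) ->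
  (forall i j, cdiffn n D (fun z => A z i j)) ->
  forall i j, cdiffn n D (fun z => invmx (A z) i j).
Proof.
move=> Au AP i j; pose M z := \matrix_(i0, j0) A z (lift j i0) (lift i j0).
apply: (@eq_on_cdiffn _
    (fun z => (\det (A z))^-1 * ((-1) ^+ (j + i) * \det (M z)))) => [z /set_mem Dz|].
  rewrite /invmx Au// !mxE /cofactor; congr (_ * (_ * \det _)).
  by apply/matrixP => k m; rewrite !mxE.
apply: cdiffnM; last first.
  apply: cdiffnM; [exact: cdiffn_cst | apply: cdiffn_det => k m].
  by apply: eq_on_cdiffn (AP (lift j k) (lift i m)) => z _; rewrite mxE.
apply: cdiffnV (cdiffn_det AP) => z /Au.
by rewrite unitmxE unitfE.
Qed.

(** A continuous linear form is its own differential, so it commutes with [cderiv]. *)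
Lemma cdiffn_linear (H : normedModType C) (phi : {linear H -> C^o}) (g : C -> H) n :
  continuous phi -> cdiffn n D g -> cdiffn n D (phi \o g : C -> C).
Proof.
move=> phic; elim: n g => // n IHn g gP.
apply: (@cdiffn_is_derive _ _ (phi \o cderiv g : C -> C)); last first.
  by apply: IHn; case/cdiffnS: gP.
move=> z Dz; have [gd gE] := cdiffn_derive gP Dz.
have /derivable1_diffP gd' := gd.
have pd := is_diff_comp (differentiableP gd')
  (differentiableP (linear_differentiable (g z) phic)).
split; first by apply/derivable1_diffP; case: pd.
rewrite deriveE; last by case: pd.
by case: pd => _ ->; rewrite diff_lin//= -gE deriveE.
Qed.

End Cdiffn.

(** * Iterated derivatives of sums, products and polynomials *)

Section Leibniz.
Variables (C : numClosedFieldType) (D : set C).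
Hypothesis D_open : open D.

Lemma cderivnD (H : normedModType C) (g h : C -> H) k z :
  cdiffn k D g -> cdiffn k D h -> D z ->
  cderivn k (fun w => g w + h w) z = cderivn k g z + cderivn k h z.
Proof.
elim: k g h => // k IHk g h gP hP Dz.
have [[_ g'P] [_ h'P]] := (proj1 (cdiffnS _ _ _) gP, proj1 (cdiffnS _ _ _) hP).
rewrite !cderivSn -IHk//; apply: eq_on_cderivn (mem_set Dz) => //.
move=> w /set_mem Dw.
by have [] := is_derive_cderiv
  (is_deriveD (cdiffn_derive gP Dw) (cdiffn_derive hP Dw)).
Qed.

Lemma cderivn_cst0 (H : normedModType C) k z : cderivn k (fun=> 0 : H) z = 0.
Proof.
elim: k z => // k IHk z; rewrite cderivSn -[RHS](IHk z); congr (cderivn k _ z).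
apply/funext => w.
by have [] := is_derive_cderiv (is_derive_cst (0 : H) w 1).
Qed.

Lemma cderivn_sum (H : normedModType C) (I : Type) (r : seq I)
    (F : I -> C -> H) k z :
  (forall i, cdiffn k D (F i)) -> D z ->
  cderivn k (fun w => \sum_(i <- r) F i w) z = \sum_(i <- r) cderivn k (F i) z.
Proof.
move=> FP Dz; elim: r => [|i r IHr].
  rewrite big_nil -[RHS](cderivn_cst0 H k z); congr (cderivn k _ z).
  by apply/funext => w; rewrite big_nil.
rewrite big_cons -IHr -cderivnD//; last exact: cdiffn_sum.
by congr (cderivn k _ z); apply/funext => w; rewrite big_cons.
Qed.

Lemma cderivn_scale (H : normedModType C) (a : C -> C) (g : C -> H) k z :
  cdiffn k D a -> cdiffn k D g -> D z ->
  cderivn k (fun w => a w *: g w) z =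
  \sum_(m < k.+1) 'C(k, m)%:R *: (cderivn (k - m) a z *: cderivn m g z).
Proof.
elim: k a g => [|k IHk] a g aP gP Dz.
  by rewrite big_ord_recl big_ord0 addr0 scale1r.
have [_ a'P] := proj1 (cdiffnS _ _ _) aP.
have [_ g'P] := proj1 (cdiffnS _ _ _) gP.
have aP' := cdiffn_le (leqnSn k) aP; have gP' := cdiffn_le (leqnSn k) gP.
rewrite cderivSn (@eq_on_cderivn _ D D_open _ _
  (fun w => cderiv a w *: g w + a w *: cderiv g w) _ _ _ (mem_set Dz)); last first.
  move=> w /set_mem Dw.
  by have [] := is_derive_cderiv
    (is_derive_scale (cdiffn_derive aP Dw) (cdiffn_derive gP Dw)).
rewrite cderivnD//; [|exact: cdiffn_scale..].
rewrite !IHk//.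
under eq_bigr => m _ do rewrite -cderivSn -subSn ?leq_ord//.
under [X in _ + X]eq_bigr => m _ do rewrite -cderivSn -subSS.
rewrite [RHS]big_ord_recl /=.
(* Pascal's rule splits the right-hand sum; the ['C(k, m)] part is the sum from deriving [g], and
   the ['C(k, m.+1)] part with the [m = 0] term is the one from deriving [a]. *)
under [in RHS]eq_bigr => m _ do rewrite binS natrD scalerDl.
rewrite big_split addrA; congr (_ + _).
rewrite big_ord_recl !bin0; congr (_ + _).
(* The surplus last term carries ['C(k, k.+1) = 0]. *)
by rewrite [RHS]big_ord_recr /= bin_small// scale0r addr0.
Qed.

Lemma is_derive_horner (p : {poly C}) (z0 z : C) :
  is_derive z 1 (fun w => p.[w - z0]) p^`().[z - z0].
Proof.
elim/poly_ind: p => [|p c IHp].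
  rewrite deriv0 horner0 (_ : (fun _ => _) = cst 0); first exact: is_derive_cst.
  by apply/funext => w; rewrite horner0.
have dz : is_derive z 1 (fun w => w - z0) 1.
  rewrite -[X in is_derive _ _ _ X]subr0.
  exact: is_deriveB.
rewrite (_ : (fun _ => _) = (fun w => p.[w - z0] *: (w - z0) + c)); last first.
  by apply/funext => w; rewrite hornerMXaddC.
rewrite derivMXaddC hornerD hornerM hornerX addrC.
rewrite -[X in is_derive _ _ _ X]addr0.
apply: is_deriveD.
have := is_derive_scale IHp dz.
by rewrite [X in is_derive _ _ _ (_ + X)]mulr1.
Qed.

Lemma cderivn_horner (p : {poly C}) (z0 : C) k :
  cderivn k (fun w => p.[w - z0]) z0 = k`!%:R * p`_k.
Proof.
have -> : cderivn k (fun w => p.[w - z0]) = (fun w => p^`(k).[w - z0]).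
  elim: k p => // k IHk p; rewrite cderivSn derivSn -IHk; congr cderivn.
  apply/funext => w.
  by have [] := is_derive_cderiv (is_derive_horner p z0 w).
by rewrite subrr horner_coef0 coef_derivn addn0 ffactnn mulr_natl.
Qed.

Lemma cdiffn_horner (p : {poly C}) (z0 : C) n :
  cdiffn n D (fun w => p.[w - z0]).
Proof.
elim: n p => // n IHn p.
have := IHn (deriv p); apply: cdiffn_is_derive => // z _; exact: is_derive_horner.
Qed.

End Leibniz.

(** * Spans, linear extension and invertible changes of family *)

Section LinSpan.
Variables (C : numClosedFieldType) (H : normedModType C).

Lemma lin_spanP (I : finType) (v : I -> H) (a : C) (x y : H) :
  lin_span v x -> lin_span v y -> lin_span v (a *: x + y).
Proof.
move=> [c ->] [d ->]; exists (fun i => a * c i + d i).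
rewrite scaler_sumr -big_split; apply: eq_bigr => i _ /=.
by rewrite scalerDl scalerA.
Qed.

Lemma lin_span0 (I : finType) (v : I -> H) : lin_span v 0.
Proof. by exists (fun=> 0); rewrite big1// => i _; rewrite scale0r. Qed.

Lemma lin_span_gen (I : finType) (v : I -> H) i : lin_span v (v i).
Proof.
exists (fun j => (j == i)%:R); rewrite (bigD1 i)//= eqxx scale1r.
by rewrite big1 ?addr0// => j /negPf ->; rewrite scale0r.
Qed.

Lemma lin_span_sum (I : finType) (v : I -> H) (J : Type) (r : seq J)
    (c : J -> C) (u : J -> H) :
  (forall j, lin_span v (u j)) -> lin_span v (\sum_(j <- r) c j *: u j).
Proof.
move=> uP; elim: r => [|j r IHr]; first by rewrite big_nil; exact: lin_span0.
by rewrite big_cons; exact: lin_spanP.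
Qed.

Lemma lin_spanZ (I : finType) (v : I -> H) (a : C) (x : H) :
  lin_span v x -> lin_span v (a *: x).
Proof. by move=> vx; rewrite -[_ *: _]addr0; apply/lin_spanP/lin_span0. Qed.

Lemma lin_span_sub (I J : finType) (v : I -> H) (u : J -> H) :
  (forall j, lin_span v (u j)) -> lin_span u `<=` lin_span v.
Proof. by move=> uP _ [c ->]; exact: lin_span_sum. Qed.

Lemma linear_on_sum (I : finType) (v : I -> H) (T : H -> H) (J : Type)
    (r : seq J) (c : J -> C) (u : J -> H) :
  linear_on (lin_span v) T -> (forall j, lin_span v (u j)) ->
  T (\sum_(j <- r) c j *: u j) = \sum_(j <- r) c j *: T (u j).
Proof.
move=> Tl uP; elim: r => [|j r IHr].
  rewrite !big_nil; have := Tl (-1) 0 0 (lin_span0 v) (lin_span0 v).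
  by rewrite scaler0 addr0 scaleN1r addNr.
by rewrite !big_cons Tl ?IHr//; exact: lin_span_sum.
Qed.

Lemma linear_on_scale (I : finType) (v : I -> H) (T : H -> H) (a : C) (x : H) :
  linear_on (lin_span v) T -> lin_span v x -> T (a *: x) = a *: T x.
Proof.
move=> Tl vx; have := @linear_on_sum _ _ _ _ [:: tt] (fun=> a) (fun=> x) Tl.
by rewrite !big_seq1; exact.
Qed.

(** Coordinates are picked by [get]; independence makes them unique on the span, hence linear
    there. *)
Lemma lin_indep_extension (I : finType) (v w : I -> H) : lin_indep v ->
  exists2 T : H -> H, linear_on (lin_span v) T & forall i, T (v i) = w i.
Proof.
move=> vI.
pose coef x := get [set c : I -> C | x = \sum_i c i *: v i].
have coefE c : coef (\sum_i c i *: v i) = c.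
  apply/funext => i; apply/eqP; rewrite -subr_eq0; apply/eqP.
  apply: (vI (fun i => coef (\sum_i c i *: v i) i - c i)).
  under eq_bigr do rewrite scalerBl.
  rewrite sumrB; apply/eqP; rewrite subr_eq0; apply/eqP/esym.
  exact: (@getPex _ [set d : I -> C | \sum_i c i *: v i = \sum_i d i *: v i]
    (ex_intro _ c erefl)).
exists (fun x => \sum_i coef x i *: w i) => [a _ _ [c ->] [d ->]|i].
  have -> : a *: (\sum_i c i *: v i) + \sum_i d i *: v i =
      \sum_i (a * c i + d i) *: v i.
    rewrite scaler_sumr -big_split; apply: eq_bigr => i _ /=.
    by rewrite scalerDl scalerA.
  rewrite !coefE scaler_sumr -big_split /=.
  by apply: eq_bigr => i _; rewrite scalerDl scalerA.
have [c vi] := lin_span_gen v i.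
have cE : c = fun j => (j == i)%:R.
  rewrite -[c]coefE -vi -[RHS]coefE; congr coef.
  rewrite (bigD1 i)//= eqxx scale1r.
  by rewrite big1 ?addr0// => j /negPf ->; rewrite scale0r.
rewrite vi coefE cE (bigD1 i)//= eqxx scale1r.
by rewrite big1 ?addr0// => j /negPf ->; rewrite scale0r.
Qed.

(** The rows of [invmx A] recover the [v j] from their combinations. *)
Lemma lin_span_mx l (A : 'M[C]_l) (v : 'I_l -> H) : A \in unitmx ->
  lin_span (fun i => \sum_j A i j *: v j) = lin_span v.
Proof.
move=> Au; apply/seteqP; split; apply: lin_span_sub => j.
  by apply: lin_span_sum => i; exact: lin_span_gen.
exists (invmx A j).
under eq_bigr do rewrite scaler_sumr.
rewrite exchange_big /=.
under eq_bigr => k _.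
  under eq_bigr do rewrite scalerA.
  rewrite -scaler_suml.
  have -> : \sum_i invmx A j i * A i k = (invmx A *m A) j k by rewrite mxE.
  rewrite mulVmx// mxE; over.
rewrite (bigD1 j)//= eqxx scale1r big1 ?addr0// => k.
by rewrite eq_sym => /negPf ->; rewrite scale0r.
Qed.

(** A nonzero row vector killed by [A] would be a nontrivial relation. *)
Lemma lin_indep_mx l (A : 'M[C]_l) (v : 'I_l -> H) :
  lin_indep (fun i => \sum_j A i j *: v j) -> A \in unitmx.
Proof.
move=> AI; rewrite unitmxE unitfE; apply/det0P => -[x x0 xA].
move/eqP: x0; apply; apply/rowP => i; rewrite mxE.
apply: (AI (x 0)).
under eq_bigr do rewrite scaler_sumr.
rewrite exchange_big big1//= => k _.
under eq_bigr do rewrite scalerA.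
rewrite -scaler_suml.
have -> : \sum_i x 0 i * A i k = (x *m A) 0 k by rewrite mxE.
by rewrite xA mxE scale0r.
Qed.

End LinSpan.

(** * Coordinates in the jet of a frame *)

Section Jets.
Variables (C : numClosedFieldType) (H : normedModType C) (l n : nat).
Implicit Types (s : 'I_l -> C -> H) (z : C).

(** Coordinates are indexed by [nat] instead of ['I_n.+1], so that shifted orders such as [k - m]
    and [k.-1] can be written without casts. *)
Lemma lin_span_jetP s z h : lin_span (@jet _ _ _ n s z) h <->
  exists c : 'I_l -> nat -> C,
    h = \sum_i \sum_(k < n.+1) c i k *: cderivn k (s i) z.
Proof.
split=> [[c ->]|[c ->]].
  exists (fun i k => c (i, inord k)); rewrite pair_big.
  by apply: eq_bigr => -[i k] _ /=; rewrite inord_val.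
exists (fun ik : 'I_l * 'I_n.+1 => c ik.1 ik.2); rewrite pair_big.
by apply: eq_bigr => -[i k] _.
Qed.

Lemma lin_indep_jetP s z (c d : 'I_l -> nat -> C) : lin_indep (@jet _ _ _ n s z) ->
  \sum_i \sum_(k < n.+1) c i k *: cderivn k (s i) z =
  \sum_i \sum_(k < n.+1) d i k *: cderivn k (s i) z ->
  forall i k, (k <= n)%N -> c i k = d i k.
Proof.
move=> sI cd i k kn; apply/eqP; rewrite -subr_eq0; apply/eqP.
have := sI (fun ik : 'I_l * 'I_n.+1 => c ik.1 ik.2 - d ik.1 ik.2) _ (i, inord k).
rewrite /= inordK//; apply.
under eq_bigr do rewrite scalerBl.
by move/eqP: cd; rewrite -subr_eq0 !pair_big sumrB => /eqP.
Qed.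

Lemma lin_span_cderivn s z i k : (k <= n)%N ->
  lin_span (@jet _ _ _ n s z) (cderivn k (s i) z).
Proof.
move=> kn; have -> : cderivn k (s i) z = jet s z (i, inord k : 'I_n.+1).
  by rewrite /jet /= inordK.
exact: lin_span_gen.
Qed.

Lemma linear_on_jet s z (T : H -> H) (c : 'I_l -> nat -> C) :
  linear_on (lin_span (@jet _ _ _ n s z)) T ->
  T (\sum_i \sum_(k < n.+1) c i k *: cderivn k (s i) z) =
  \sum_i \sum_(k < n.+1) c i k *: T (cderivn k (s i) z).
Proof.
move=> Tl; rewrite !pair_big; apply: (linear_on_sum _ _ Tl) => -[i k] /=.
by apply: lin_span_cderivn; rewrite -ltnS.
Qed.

End Jets.

(** * Continuity of the inner product and Gram matrices *)

Section Dot.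
Variables (C : numClosedFieldType) (H : normedModType C).
Variable dot : {dot H for Num.conj}.
Hypothesis norm_dot : norm_from_dot dot.

(** Expresses [dot] through the norm, whose continuity then gives that of [dot]. *)
Lemma dot_polarization x y : dot x y =
  2^-1 * ((`|x + y| ^+ 2 - `|x| ^+ 2 - `|y| ^+ 2) +
          'i * (`|x + 'i *: y| ^+ 2 - `|x| ^+ 2 - `|y| ^+ 2)).
Proof.
rewrite !norm_dot dnormD dnormD dnormZ normCi expr1n mul1r.
rewrite linearZr_LR /= conjCi.
set d := dot x y; rewrite rmorphM rmorphN /= conjCi opprK.
rewrite [X in _ * (X + _)](_ : _ = d + d^*); last by ring.
rewrite [X in _ * (_ + _ * X)](_ : _ = - 'i * d + 'i * d^*); last by ring.
transitivity (2^-1 * (d + d^* - 'i ^+ 2 * (d - d^*))); last by ring.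
by rewrite sqrCi; field.
Qed.

Lemma dotl_continuous y :
  exists2 phi : {linear H -> C^o}, continuous phi & forall x, phi x = dot x y.
Proof.
have lin : linear (fun x => dot x y : C^o).
  by move=> a u v; rewrite linearPl.
pose M := GRing.isLinear.Build _ _ _ _ _ lin.
pose phi : {linear H -> C^o} := HB.pack (fun x => dot x y : C^o) M.
exists phi => // x.
rewrite (_ : phi = (fun x => 2^-1 * ((`|x + y| ^+ 2 - `|x| ^+ 2 - `|y| ^+ 2) +
          'i * (`|x + 'i *: y| ^+ 2 - `|x| ^+ 2 - `|y| ^+ 2))) :> (H -> C)).
  have Nc w : (fun x => `|x + w| ^+ 2) @ x --> `|x + w| ^+ 2.
    have nc : (fun x => `|x + w|) @ x --> `|x + w|.
      by apply: cvg_norm; apply: cvgD; [exact: cvg_id|exact: cvg_cst].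
    exact: (cvgM nc nc).
  have N0 : (fun x : H => `|x| ^+ 2) @ x --> `|x| ^+ 2.
    have nc : (fun x : H => `|x|) @ x --> `|x| by apply: cvg_norm; exact: cvg_id.
    exact: (cvgM nc nc).
  apply: cvgM; first exact: cvg_cst.
  apply: cvgD; last (apply: cvgM; first exact: cvg_cst);
  by apply: cvgB; [apply: cvgB|exact: cvg_cst].
by apply/funext => w; rewrite -dot_polarization.
Qed.

(** A row in the kernel gives a combination [h] orthogonal to every [v j], hence to itself, so
    [h = 0]. *)
Lemma gram_unitmx l (v : 'I_l -> H) : lin_indep v ->
  \matrix_(i, j) dot (v i) (v j) \in unitmx.
Proof.
move=> vI; rewrite unitmxE unitfE; apply/det0P => -[x x0 xG].
move/eqP: x0; apply; apply/rowP => i; rewrite mxE.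
apply: (vI (x 0)); set h := \sum_i _.
have hv j : dot h (v j) = 0.
  have := congr1 (fun M : 'rV[C]_l => M 0 j) xG; rewrite !mxE => <-.
  by rewrite linear_sumlz; apply: eq_bigr => k _; rewrite linearZl_LR !mxE.
apply/eqP; rewrite -(dnorm_eq0 dot) {2}/h linear_sumr big1//= => j _.
by rewrite linearZr_LR /= hv mulr0.
Qed.

End Dot.

(** * Change of frame, and frame independence of the jet fibre and the Pascal map *)

Lemma open_neq0 (C : numClosedFieldType) (D : set C) (a : C -> C) z :
  open D -> D z -> {for z, continuous a} -> a z != 0 ->
  exists D' : set C,
    [/\ open D', D' z, D' `<=` D & forall w, D' w -> a w != 0].
Proof.
move=> Do Dz ac az; exists (D `&` [set w | a w != 0])°.
have sub := @interior_subset _ (D `&` [set w | a w != 0]).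
split=> [||w /sub[]|w /sub[]]//; first exact: open_interior.
apply: filterI; first exact: open_nbhs_nbhs.
exact: cvgr_neq0 ac az.
Qed.

Section Frames.
Variables (C : numClosedFieldType) (H : normedModType C).
Variable dot : {dot H for Num.conj}.
Hypothesis norm_dot : norm_from_dot dot.
Variables (Omega : set C) (l n : nat) (f : C -> set H).
Hypotheses (n_gt0 : (0 < n)%N) (f_nondeg : n_nondegenerate Omega l n f).
Implicit Types (s : 'I_l -> C -> H) (z : C).

(* A junk derivative is 0, so linear independence of the jets forces the      *)
(* derivatives of a frame to exist, without any appeal to Cauchy's theory.    *)
Lemma frame_cdiffn s z : holomorphic_frame Omega f z s ->
  exists D : set C,
    [/\ open D, D z, D `<=` Omega, forall i, cdiffn n D (s i) &
        forall w, D w -> f w = lin_span (fun i => s i w)].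
Proof.
move=> [D [Do Dz DO sh fs]]; exists D; split=> // i k kn w Dw.
apply: cderiv_neq0_differentiable; apply/eqP => s0.
have sI : lin_indep (@jet _ _ _ n s w).
  by apply: f_nondeg; [exact: DO|exists D; split].
pose e : 'I_l * 'I_n.+1 := (i, inord k.+1).
have se : \sum_ik (ik == e)%:R *: jet s w ik = 0.
  rewrite (bigD1 e)//= eqxx scale1r big1 => [|ik /negPf ->]; last first.
    by rewrite scale0r.
  by rewrite addr0 /jet /= inordK.
by have := sI _ se e; rewrite eqxx => /eqP; rewrite oner_eq0.
Qed.

Lemma lin_indep_frame s z : Omega z -> holomorphic_frame Omega f z s ->
  lin_indep (fun i => s i z).
Proof.
move=> Oz fr c c0 i.
(* A relation among the [s i z] is a relation among the jets, with zero coefficients in positive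
   order. *)
apply: (@lin_indep_jetP _ _ _ _ _ _ (fun i k => c i *+ (k == 0)%N) (fun _ _ => 0)
  (f_nondeg Oz fr) _ i 0%N (leq0n n)).
rewrite [RHS]big1 => [|j _]; last by rewrite big1// => k _; rewrite scale0r.
rewrite -[RHS]c0; apply: eq_bigr => j _.
by rewrite big_ord_recl /= big1 ?addr0// => k _; rewrite scale0r.
Qed.

Lemma frame_transition s s' z :
  Omega z -> holomorphic_frame Omega f z s -> holomorphic_frame Omega f z s' ->
  exists (D : set C) (A : C -> 'M[C]_l),
    [/\ open D, D z, forall i j, cdiffn n D (fun w => A w i j),
        forall i, cdiffn n D (s i) &
        forall w, D w -> forall i, s' i w = \sum_j A w i j *: s j w].
Proof.
move=> Oz fr fr'.
have sI := lin_indep_frame Oz fr.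
have [D1 [D1o D1z _ sP fs]] := frame_cdiffn fr.
have [D2 [D2o D2z _ s'P fs']] := frame_cdiffn fr'.
pose D0 := D1 `&` D2.
have D0o : open D0 by exact: openI.
have D0z : D0 z by [].
have dotP (g : C -> H) m : cdiffn n D0 g -> cdiffn n D0 (fun w => dot (g w) (s m z)).
  move=> gP; have [phi phic phiE] := dotl_continuous norm_dot (s m z).
  apply: eq_on_cdiffn (cdiffn_linear D0o phic gP) => // w _.
  exact: phiE.
(* The second argument stays at [z]: [dot] is conjugate-linear there, so letting it vary with [w]
   would destroy holomorphy. *)
pose G w := \matrix_(i, j) dot (s i w) (s j z).
pose B w := \matrix_(i, j) dot (s' i w) (s j z).
have GP i j : cdiffn n D0 (fun w => G w i j).
  apply: eq_on_cdiffn (dotP (s i) j _) => // [w _|k kn w [D1w _]].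
    by rewrite mxE.
  exact: sP.
have BP i j : cdiffn n D0 (fun w => B w i j).
  apply: eq_on_cdiffn (dotP (s' i) j _) => // [w _|k kn w [_ D2w]].
    by rewrite mxE.
  exact: s'P.
have Gz : \det (G z) != 0.
  by have := gram_unitmx dot sI; rewrite unitmxE unitfE.
have detG : {for z, continuous (fun w => \det (G w))}.
  apply: differentiable_continuous.
  (* Since [0 < n], order [n] includes differentiability of the determinant itself, hence its
     continuity. *)
  exact: (cdiffn_det D0o GP n_gt0 D0z).
have [D [Do Dz DD0 GD]] := open_neq0 D0o D0z detG Gz.
have Gu w : D w -> G w \in unitmx by move=> /GD; rewrite unitmxE unitfE.
have sub (K : normedModType C) (g : C -> K) : cdiffn n D0 g -> cdiffn n D g.
  by move=> gP k kn w /DD0; exact: gP.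
exists D, (fun w => B w *m invmx (G w)); split=> //.
- move=> i j.
  apply: (@eq_on_cdiffn _ _ Do _ (fun w => \sum_k B w i k * invmx (G w) k j)).
    by move=> w _; rewrite mxE.
  apply: cdiffn_sum => // k _; apply: cdiffnM => //; first exact/sub/BP.
  by apply: cdiffn_invmx => // i0 j0; exact/sub/GP.
- by move=> i k kn w /DD0[D1w _]; exact: sP.
- move=> w Dw i; have [D1w D2w] := DD0 w Dw.
  have /choice[c cE] j : exists c : 'I_l -> C, s' j w = \sum_k c k *: s k w.
    have : f w (s' j w) by rewrite fs'//; exact: (lin_span_gen (fun i => s' i w)).
    by rewrite fs// => -[c ->]; exists c.
  (* Pairing the expansion of [s'] in [s] with the [s j z] gives [B = c G], so the pointwise
     coordinates [c] equal [B G^-1]. *)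
  have -> : B w = (\matrix_(j, k) c j k) *m G w.
    apply/matrixP => j k; rewrite !mxE cE linear_sumlz.
    by apply: eq_bigr => m _; rewrite linearZl_LR !mxE.
  rewrite mulmxK ?Gu// cE; apply: eq_bigr => j _; by rewrite mxE.
Qed.

(** Leibniz' rule with the inner sum padded from [k.+1] to [n.+1] terms, so that it reads as
    coordinates in the jet. *)
Lemma cderivn_frame (D : set C) (a : 'I_l -> C -> C) s z k :
  open D -> D z -> (forall j, cdiffn n D (a j)) -> (forall j, cdiffn n D (s j)) ->
  (k <= n)%N ->
  cderivn k (fun w => \sum_j a j w *: s j w) z =
  \sum_j \sum_(m < n.+1)
    ('C(k, m)%:R * cderivn (k - m) (a j) z) *: cderivn m (s j) z.
Proof.
move=> Do Dz aP sP kn; have le := fun K g => @cdiffn_le _ D K g _ _ kn.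
rewrite (@cderivn_sum _ D)//; last first.
  by move=> j; apply: cdiffn_scale => //; exact: le.
apply: eq_bigr => j _; rewrite (@cderivn_scale _ D)//; [|exact: le..].
rewrite (big_ord_widen_cond n.+1 predT
  (fun m => 'C(k, m)%:R *: (cderivn (k - m) (a j) z *: cderivn m (s j) z)))//.
rewrite big_mkcond; apply: eq_bigr => m _ /=.
by case: ltnP => km; rewrite ?scalerA// bin_small// mul0r scale0r.
Qed.

Lemma frame_transition_jet s s' z :
  Omega z -> holomorphic_frame Omega f z s -> holomorphic_frame Omega f z s' ->
  exists a : 'I_l -> 'I_l -> nat -> C, forall i k, (k <= n)%N ->
    cderivn k (s' i) z =
    \sum_j \sum_(m < n.+1) ('C(k, m)%:R * a i j (k - m)%N) *: cderivn m (s j) z.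
Proof.
move=> Oz fr fr'; have [D [A [Do Dz AP sP s'E]]] := frame_transition Oz fr fr'.
exists (fun i j r => cderivn r (fun w => A w i j) z) => i k kn.
rewrite -(cderivn_frame Do Dz (AP i) sP kn).
apply: (eq_on_cderivn Do) (mem_set Dz) => w /set_mem Dw.
exact: s'E.
Qed.

Lemma jet_fiberE s z : Omega z -> holomorphic_frame Omega f z s ->
  jet_fiber Omega l n f z = lin_span (@jet _ _ _ n s z).
Proof.
move=> Oz fr; apply/seteqP; split=> [h [s' fr']|h hs]; last by exists s.
apply: lin_span_sub => -[i k]; rewrite /jet /=.
have [a ->] := frame_transition_jet Oz fr fr'; last by rewrite -ltnS.
by apply/lin_span_jetP; exists (fun j m => 'C(k, m)%:R * a i j (k - m)%N).
Qed.

Lemma pascal_forE s z (T : H -> H) : pascal_for n s z T ->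
  forall i k, (k <= n)%N ->
    T (cderivn k (s i) z) = k%:R *: cderivn k.-1 (s i) z.
Proof. by move=> [_ T0 TS] i [_|k kn]; [rewrite scale0r; exact: T0|exact: TS]. Qed.

Lemma pascal_for_frame s s' z (T : H -> H) :
  Omega z -> holomorphic_frame Omega f z s -> holomorphic_frame Omega f z s' ->
  pascal_for n s z T -> pascal_for n s' z T.
Proof.
move=> Oz fr fr' Ts; have [Tl T0 _] := Ts.
have [a s'E] := frame_transition_jet Oz fr fr'.
have Ts' i k : (k <= n)%N ->
    T (cderivn k (s' i) z) = k%:R *: cderivn k.-1 (s' i) z.
  move=> kn; rewrite s'E//.
  rewrite (linear_on_jet (fun j m => 'C(k, m)%:R * a i j (k - m)%N) Tl).
  rewrite s'E ?(leq_trans (leq_pred k))// scaler_sumr.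
  (* [T] lowers the order by one: the [m = 0] term on the left vanishes, and term [m.+1] on the left
     is matched with term [m] on the right. *)
  apply: eq_bigr => j _; rewrite scaler_sumr big_ord_recl [RHS]big_ord_recr /=.
  rewrite T0 scaler0 add0r.
  (* The unmatched top term vanishes by the factor [k] if [k = 0], and otherwise because
     [k.-1 < n]. *)
  have -> : k%:R *: (('C(k.-1, n)%:R * a i j (k.-1 - n)%N) *: cderivn n (s j) z) = 0.
    case: k kn => [|k] kn; first by rewrite scale0r.
    by rewrite bin_small// mul0r scale0r scaler0.
  rewrite addr0; apply: eq_bigr => m _.
  rewrite (pascal_forE Ts j (ltn_ord m)) !scalerA /=; congr (_ *: _).
  (* The identity (m+1) binom(k,m+1) = k binom(k-1,m) is what makes the Pascal map independent of
     the frame. *)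
  rewrite mulrAC -natrM mulnC -mul_bin_diag natrM mulrA; congr (_ * a i j _).
  by case: k {kn} => [|k]//; rewrite subSS.
split; last 2 first.
- by move=> i; have := Ts' i 0%N isT; rewrite scale0r.
- by move=> i k /andP[_]; exact: Ts'.
by rewrite -(jet_fiberE Oz fr') (jet_fiberE Oz fr).
Qed.

(** Independence of the jets supplies one Pascal map, so the [get] in [pascal] succeeds for some
    frame; the change of frame carries the result to [s]. *)
Lemma pascal_forP s z : Omega z -> holomorphic_frame Omega f z s ->
  pascal_for n s z (pascal Omega l n f z).
Proof.
move=> Oz fr.
have [T Tl Tjet] := lin_indep_extension
  (fun ik : 'I_l * 'I_n.+1 => (ik.2 : nat)%:R *: cderivn ik.2.-1 (s ik.1) z)
  (f_nondeg Oz fr).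
have Ts : pascal_for n s z T.
  have TE i k : (k <= n)%N ->
      T (cderivn k (s i) z) = k%:R *: cderivn k.-1 (s i) z.
    by move=> kn; have := Tjet (i, inord k); rewrite /jet /= inordK.
  split=> // [i|i k /andP[_]]; last exact: TE.
  by have := TE i 0%N isT; rewrite scale0r.
have /getPex[s' fr' Ts'] : exists T', exists2 s' : 'I_l -> C -> H,
    holomorphic_frame Omega f z s' & pascal_for n s' z T' by exists T, s.
exact: pascal_for_frame Ts'.
Qed.

End Frames.

(** * Linear maps on subspaces and coordinates relative to a Pascal map *)

Section LinearOn.
Variables (C : numClosedFieldType) (H : normedModType C).

Lemma linear_on_comp (A B : set H) (T U : H -> H) :
  linear_on A T -> (forall x, A x -> B (T x)) -> linear_on B U ->
  linear_on A (U \o T).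
Proof. by move=> Tl TB Ul a x y Ax Ay /=; rewrite Tl// Ul//; exact: TB. Qed.

Lemma eq_linear_on (I : finType) (v : I -> H) (T U : H -> H) :
  linear_on (lin_span v) T -> linear_on (lin_span v) U ->
  (forall i, T (v i) = U (v i)) -> {in lin_span v, T =1 U}.
Proof.
move=> Tl Ul TU x /set_mem[c ->].
by rewrite (linear_on_sum _ _ Tl) ?(linear_on_sum _ _ Ul)//;
  [apply: eq_bigr => i _; rewrite TU|exact: lin_span_gen..].
Qed.

Lemma lin_span_linear_on (I : finType) (v : I -> H) (T : H -> H) :
  linear_on (lin_span v) T -> (forall i, lin_span v (T (v i))) ->
  forall x, lin_span v x -> lin_span v (T x).
Proof.
move=> Tl Tv _ [c ->]; rewrite (linear_on_sum _ _ Tl); last exact: lin_span_gen.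
exact: lin_span_sum.
Qed.

Lemma pascal_for_stable l n (s : 'I_l -> C -> H) z (T : H -> H) :
  pascal_for n s z T ->
  forall x, lin_span (@jet _ _ _ n s z) x -> lin_span (@jet _ _ _ n s z) (T x).
Proof.
move=> Ts; have [Tl _ _] := Ts; apply: (lin_span_linear_on Tl) => -[i k].
rewrite /jet /= (pascal_forE Ts _ (leq_ord k)); apply/lin_spanZ/lin_span_cderivn.
exact: leq_trans (leq_pred k) (leq_ord k).
Qed.

(* Comparing the coordinates of [P v_k] and [k v_(k-1)] gives                 *)
(* (m+1) c_(k,m+1) = k c_(k-1,m), whence c_(k,m) = binom(k,m) c_(k-m,0).      *)
Lemma pascal_coord l n (t : 'I_l -> C -> H) z (P : H -> H) (v : nat -> H)
    (c : nat -> 'I_l -> nat -> C) :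
  lin_indep (@jet _ _ _ n t z) -> pascal_for n t z P ->
  (forall k, (k <= n)%N ->
    v k = \sum_j \sum_(m < n.+1) c k j m *: cderivn m (t j) z) ->
  (forall k, (k <= n)%N -> P (v k) = k%:R *: v k.-1) ->
  forall k j m, (k <= n)%N -> (m <= n)%N ->
    c k j m = 'C(k, m)%:R * c (k - m)%N j 0%N.
Proof.
move=> tI Pt vE Pv.
have step k j m : (k <= n)%N -> (m < n)%N ->
    m.+1%:R * c k j m.+1 = k%:R * c k.-1 j m.
  move=> kn mn.
  (* The coordinates of [P (v k)]: those of [v k] shifted down, with 0 at order [n], which [P] never
     reaches. *)
  pose d j m := if (m < n)%N then m.+1%:R * c k j m.+1 else 0.
  have [Pl P0 _] := Pt.
  have dE : \sum_j \sum_(m < n.+1) d j m *: cderivn m (t j) z =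
      \sum_j \sum_(m < n.+1) (k%:R * c k.-1 j m) *: cderivn m (t j) z.
    transitivity (k%:R *: v k.-1); last first.
      rewrite vE ?(leq_trans (leq_pred k))// scaler_sumr.
      apply: eq_bigr => i _; rewrite scaler_sumr.
      by apply: eq_bigr => r _; rewrite scalerA.
    rewrite -Pv// vE// (linear_on_jet (c k) Pl).
    apply: eq_bigr => i _; rewrite big_ord_recr [RHS]big_ord_recl /=.
    rewrite P0 scaler0 add0r /d ltnn scale0r addr0.
    apply: eq_bigr => r _.
    by rewrite (pascal_forE Pt i (ltn_ord r)) scalerA ltn_ord mulrC.
  have := @lin_indep_jetP _ _ _ _ _ _ d (fun j m => k%:R * c k.-1 j m)
    tI dE j m (ltnW mn).
  by rewrite /d mn.
move=> k j m; elim: m k => [|m IHm] k kn mn.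
  by rewrite bin0 mul1r subn0.
have m0 : m.+1%:R != 0 :> C by rewrite pnatr_eq0.
apply: (mulfI m0); rewrite step// IHm ?(ltnW mn) ?(leq_trans (leq_pred k))//.
rewrite !mulrA -!natrM mul_bin_diag; congr (_ * c _ j _).
by case: k {kn} => [|k]//; rewrite subSS.
Qed.

End LinearOn.

(** * The two implications between contact and intertwining *)

Section Contact.
Variables (C : numClosedFieldType) (H : normedModType C).
Variable dot : {dot H for Num.conj}.
Hypothesis norm_dot : norm_from_dot dot.
Variables (Omega : set C) (l n : nat) (f ft : C -> set H) (z : C).
Hypotheses (n_gt0 : (0 < n)%N) (Oz : Omega z).
Hypotheses (f_hol : holomorphic_map Omega l f)
  (ft_hol : holomorphic_map Omega l ft).
Hypotheses (f_nondeg : n_nondegenerate Omega l n f)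
  (ft_nondeg : n_nondegenerate Omega l n ft).

Lemma contact_pascal_intertwining :
  contact Omega l n f ft z ->
  exists2 Phi : H -> H,
    linear_isometry_on (jet_fiber Omega l n f z) (jet_fiber Omega l n ft z)
      Phi &
    forall x, jet_fiber Omega l n f z x ->
      Phi (pascal Omega l n f z x) = pascal Omega l n ft z (Phi x).
Proof.
move=> [s [st [fr frt [T TE Tiso]]]]; exists T => //.
have [TB Tl _] := Tiso.
have Ps := pascal_forP norm_dot n_gt0 f_nondeg Oz fr.
have Pst := pascal_forP norm_dot n_gt0 ft_nondeg Oz frt.
have [[Pl _ _] [Ptl _ _]] := (Ps, Pst).
rewrite (jet_fiberE norm_dot n_gt0 f_nondeg Oz fr) in Tl TB *.
rewrite (jet_fiberE norm_dot n_gt0 ft_nondeg Oz frt) in TB.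
(* Both composites are linear on the fibre, so they need only be compared on the jet of [s], where
   each gives [k] times the jet vector of [st] of order [k.-1]. *)
move=> x /mem_set; apply: (@eq_linear_on _ _ _ _
  (T \o pascal Omega l n f z) (pascal Omega l n ft z \o T)).
- by apply: linear_on_comp Pl _ Tl; exact: pascal_for_stable.
- exact: linear_on_comp Tl TB Ptl.
move=> [i k]; rewrite /jet /=.
have kn : (k <= n)%N by rewrite -ltnS.
have k1n : (k.-1 <= n)%N by rewrite (leq_trans (leq_pred k)).
rewrite (pascal_forE Ps)// TE// (pascal_forE Pst)//.
by rewrite (linear_on_scale _ Tl) ?TE//; exact: lin_span_cderivn.
Qed.

Lemma pascal_intertwining_contact (Phi : H -> H) :
  linear_isometry_on (jet_fiber Omega l n f z) (jet_fiber Omega l n ft z)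
    Phi ->
  (forall x, jet_fiber Omega l n f z x ->
    Phi (pascal Omega l n f z x) = pascal Omega l n ft z (Phi x)) ->
  contact Omega l n f ft z.
Proof.
move=> Phi_iso PhiP; have [_ /(_ z Oz)[s fr]] := f_hol.
have [_ /(_ z Oz)[t frt]] := ft_hol.
have Ps := pascal_forP norm_dot n_gt0 f_nondeg Oz fr.
have Pt := pascal_forP norm_dot n_gt0 ft_nondeg Oz frt.
have [PhiB Phil PhiN] := Phi_iso.
have sE := jet_fiberE norm_dot n_gt0 f_nondeg Oz fr.
have tE := jet_fiberE norm_dot n_gt0 ft_nondeg Oz frt.
rewrite sE in Phil PhiB PhiP PhiN; rewrite tE in PhiB.
have /choice[c0 c0E] (ik : 'I_l * nat) : exists c : 'I_l -> nat -> C,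
    (ik.2 <= n)%N -> Phi (cderivn ik.2 (s ik.1) z) =
      \sum_j \sum_(m < n.+1) c j m *: cderivn m (t j) z.
  have [kn|] := boolP (ik.2 <= n)%N; last by exists (fun _ _ => 0).
  have /lin_span_jetP[c cE] := PhiB _ (lin_span_cderivn s z ik.1 kn).
  by exists c.
pose c i k := c0 (i, k).
have cE i k : (k <= n)%N -> Phi (cderivn k (s i) z) =
    \sum_j \sum_(m < n.+1) c i k j m *: cderivn m (t j) z.
  exact: (c0E (i, k)).
have cC i : forall k j m, (k <= n)%N -> (m <= n)%N ->
    c i k j m = 'C(k, m)%:R * c i (k - m)%N j 0%N.
  apply: (pascal_coord (ft_nondeg Oz frt) Pt (cE i)) => k kn.
  rewrite -PhiP; last exact: lin_span_cderivn.
  rewrite (pascal_forE Ps)// (linear_on_scale _ Phil)//.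
  by apply: lin_span_cderivn; rewrite (leq_trans (leq_pred k)).
(* Dividing by [r!] makes the derivative of order [r] at [z] equal to [c i r j 0]. *)
pose p i j := \poly_(r < n.+1) (c i r j 0%N / r`!%:R).
pose A w := \matrix_(i, j) (p i j).[w - z].
pose st i w := \sum_j (p i j).[w - z] *: t j w.
have [D [Do Dz DO tP ft_span]] := frame_cdiffn ft_nondeg frt.
have pP i j m : cdiffn m D (fun w => (p i j).[w - z]) by exact: cdiffn_horner.
have stE i k : (k <= n)%N -> cderivn k (st i) z = Phi (cderivn k (s i) z).
  move=> kn; rewrite (cderivn_frame Do Dz (pP i ^~ n) tP kn) cE//.
  apply: eq_bigr => j _; apply: eq_bigr => m _.
  rewrite cC ?leq_ord// cderivn_horner coef_poly.
  by rewrite ltnS (leq_trans (leq_subr m k) kn) [X in _ * X]mulrCA divff ?mulr1//.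
(* [Phi] preserves norms, hence is injective on the fibre, so the vectors [st i z = Phi (s i z)] are
   independent. *)
have Az : A z \in unitmx.
  apply: (@lin_indep_mx _ _ _ _ (fun j => t j z)) => b b0 i.
  have b0' : \sum_i b i *: st i z = 0.
    rewrite -[RHS]b0; apply: eq_bigr => j _; congr (_ *: _).
    by apply: eq_bigr => k _; rewrite mxE.
  have Phib : Phi (\sum_i b i *: s i z) = 0.
    rewrite (linear_on_sum _ _ Phil) => [|j]; last exact: (lin_span_cderivn s z j (leq0n n)).
    rewrite -[RHS]b0'; apply: eq_bigr => j _.
    by congr (_ *: _); exact/esym/(stE j 0%N).
  have sb : \sum_i b i *: s i z = 0.
    apply/eqP; rewrite -normr_eq0 -PhiN ?Phib ?normr0//.
    by apply: lin_span_sum => j; exact: (lin_span_cderivn s z j (leq0n n)).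
  exact: (lin_indep_frame f_nondeg Oz fr) sb i.
have detA : {for z, continuous (fun w => \det (A w))}.
  apply: differentiable_continuous.
  have AP i j : cdiffn 1 D (fun w => A w i j).
    by apply: eq_on_cdiffn (pP i j 1%N) => // w _; rewrite mxE.
  exact: (cdiffn_det Do AP (leqnn 1) Dz).
have Az0 : \det (A z) != 0 by move: Az; rewrite unitmxE unitfE.
(* On [D'] the matrix [A w] stays invertible, so [st] spans the same subspaces as [t] and is a frame
   of [ft]. *)
have [D' [D'o D'z D'D AD']] := open_neq0 Do Dz detA Az0.
exists s, st; split=> //.
  exists D'; split=> //.
  - by move=> w /D'D /DO.
  - move=> i w /D'D Dw.
    have stP : cdiffn n D (st i).
      by apply: cdiffn_sum => // j _; apply: cdiffn_scale.
    exact: (stP 0%N).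
  - move=> w D'w; rewrite ft_span; last exact: D'D.
    rewrite -(@lin_span_mx _ _ _ (A w)) ?unitmxE ?unitfE ?AD'//.
    congr lin_span; apply/funext => i; apply: eq_bigr => j _.
    by rewrite mxE.
exists Phi => // i k kn; exact/esym/stE.
Qed.

End Contact.

Theorem proposition4p2 (R : realType) (H : completeNormedModType R[i])
    (dot : {dot H for Num.conj}) (Hdot : norm_from_dot dot)
    (l n : nat) (l_gt0 : (0 < l)%N) (n_gt0 : (0 < n)%N)
    (Omega : set R[i]) (Omega_domain : domain Omega)
    (f ft : R[i] -> set H)
    (f_hol : holomorphic_map Omega l f) (ft_hol : holomorphic_map Omega l ft)
    (f_nondeg : n_nondegenerate Omega l n f)
    (ft_nondeg : n_nondegenerate Omega l n ft)
    (z0 : R[i]) (z0_Omega : Omega z0) :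
  contact Omega l n f ft z0 <->
  exists2 Phi : H -> H,
    linear_isometry_on (jet_fiber Omega l n f z0) (jet_fiber Omega l n ft z0)
      Phi &
    forall x, jet_fiber Omega l n f z0 x ->
      Phi (pascal Omega l n f z0 x) = pascal Omega l n ft z0 (Phi x).
Proof.
split; first exact: (contact_pascal_intertwining Hdot n_gt0 z0_Omega f_nondeg).
by case=> Phi; exact: (pascal_intertwining_contact Hdot n_gt0 z0_Omega).
Qed.
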